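(* On the set $P_-=\{(q,v)\in TS^3:\ q_0\neq\pm1,\ E(q,v)<0\}$ one has $$\Phi_c\circ\Psi=\Phi .$$
   Context: Notation: $\langle\cdot,\cdot\rangle$ is the Euclidean inner product on $\mathbb{R}^4$; $\cdot$, $\times$, $|\cdot|$ are the dot product, cross product and norm on $\mathbb{R}^3$. Write $q=(q_0,\boldsymbol q)$, $v=(v_0,\boldsymbol v)\in\mathbb{R}\times\mathbb{R}^3$, and $TS^3=\{(q,v): \langle q,q\rangle=1,\ \langle q,v\rangle=0\}$. Fix $\gamma>0$. On $\{(q,v)\in TS^3:q_0\neq\pm1\}$ set $\boldsymbol\pi=q_0\boldsymbol v-v_0\boldsymbol q$ and $E=\frac12|\boldsymbol\pi|^2-\gamma\frac{q_0}{|\boldsymbol q|}$; $E<0$ forces $q_0>0$. Map $\Phi$ (Ligon–Schaaf map for the Kepler problem on $S^3$), defined where $E<0$: with $\nu=\gamma/\sqrt{-2E}$, $$\alpha=(\alpha_0,\boldsymbol\alpha)=\Big(\frac{1}{\nu q_0}\,\boldsymbol q\cdot\boldsymbol\pi,\ \frac{\boldsymbol q}{|\boldsymbol q|}-\frac{\boldsymbol q\cdot\boldsymbol\pi}{\gamma q_0}\boldsymbol\pi\Big),\quad \beta=\Big(\frac{|\boldsymbol q|}{\gamma q_0}\boldsymbol\pi\cdot\boldsymbol\pi-1,\ \frac{|\boldsymbol q|}{\nu q_0}\boldsymbol\pi\Big),\quad \varphi=\alpha_0,$$ $\Phi(q,v)=\big(\alpha\sin\varphi+\beta\cos\varphi,\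 \nu(-\alpha\cos\varphi+\beta\sin\varphi)\big)\in\mathbb{R}^4\times\mathbb{R}^4$. Map $\Psi$ (gnomonic map), defined for $0<q_0<1$: $\Psi(q,v)=(\boldsymbol Q,\boldsymbol V)=(\boldsymbol q/q_0,\boldsymbol\pi)\in(\mathbb{R}^3\setminus\{0\})\times\mathbb{R}^3$. Map $\Phi_c$ (Ligon–Schaaf map for the Kepler problem in $\mathbb{R}^3$), defined on $\{(\boldsymbol Q,\boldsymbol V)\in(\mathbb{R}^3\setminus\{0\})\times\mathbb{R}^3: H_K<0\}$ where $H_K(\boldsymbol Q,\boldsymbol V)=\frac12\boldsymbol V\cdot\boldsymbol V-\frac{\gamma}{|\boldsymbol Q|}$: with $\nu_c=\gamma/\sqrt{-2H_K}$, $$\alpha_c=(\alpha_{c,0},\boldsymbol\alpha_c)=\Big(\frac{1}{\nu_c}\boldsymbol V\cdot\boldsymbol Q,\ \frac{\boldsymbol Q}{|\boldsymbol Q|}-\frac{\boldsymbol V\cdot\boldsymbol Q}{\gamma}\boldsymbol V\Big),\quad \beta_c=\Big(\frac{|\boldsymbol Q|}{\gamma}\boldsymbol V\cdot\boldsymbol V-1,\ \frac{|\boldsymbol Q|}{\nu_c}\boldsymbol V\Big),\quad\varphi_c=\alpha_{c,0},$$ $\Phi_c(\boldsymbol Q,\boldsymbol V)=\big(\alpha_c\sin\varphi_c+\beta_c\cos\varphi_c,\ \nu_c(-\alpha_c\cos\varphi_c+\beta_c\sin\varphi_c)\big)$. *)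

(* Defs.v *)
From HB Require Import structures.
From mathcomp Require Import all_boot all_order all_algebra.
From mathcomp Require Import classical_sets reals trigo.

Set Implicit Arguments.
Unset Strict Implicit.
Unset Printing Implicit Defensive.

Import Order.TTheory GRing.Theory Num.Theory.
Local Open Scope classical_set_scope.
Local Open Scope ring_scope.

Notation R3 R := 'rV[R]_3.

(* R^4 is R x R^3; the first factor is written R^o so that pairs carry the
   scalar multiplication of a module over R. *)
Notation R4 R := (R^o * 'rV[R]_3)%type.

Section Maps.
Variables (R : realType) (gamma : R).
Implicit Types (p : R4 R * R4 R) (x y : R3 R) (s : R3 R * R3 R).

Definition dot x y : R := \sum_i x 0 i * y 0 i.

(* The norm `|x| that the library puts on row vectors is the sup norm. *)
Definition enorm x : R := Num.sqrt (dot x x).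

Definition dot4 (a b : R4 R) : R := a.1 * b.1 + dot a.2 b.2.

Definition TS3 : set (R4 R * R4 R) :=
  [set p | dot4 p.1 p.1 = 1 /\ dot4 p.1 p.2 = 0].

(* The vector written as a bold pi: q_0 v - v_0 q. *)
Definition bpi p : R3 R := p.1.1 *: p.2.2 - p.2.1 *: p.1.2.

Definition energy p : R :=
  2^-1 * enorm (bpi p) ^+ 2 - gamma * (p.1.1 / enorm p.1.2).

Definition P_minus : set (R4 R * R4 R) :=
  [set p | TS3 p /\ (p.1.1 <> 1 /\ p.1.1 <> -1) /\ energy p < 0].

(* The maps below are total functions; each is meant on the domain given
   next to it (P_minus for Phi). *)

Definition nu p : R := gamma / Num.sqrt (- (2 * energy p)).

Definition alpha p : R4 R :=
  (1 / (nu p * p.1.1) * dot p.1.2 (bpi p),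
   (enorm p.1.2)^-1 *: p.1.2
     - (dot p.1.2 (bpi p) / (gamma * p.1.1)) *: bpi p).

Definition beta p : R4 R :=
  (enorm p.1.2 / (gamma * p.1.1) * dot (bpi p) (bpi p) - 1,
   (enorm p.1.2 / (nu p * p.1.1)) *: bpi p).

Definition Phi p : R4 R * R4 R :=
  let phi : R := (alpha p).1 in
  (sin phi *: alpha p + cos phi *: beta p,
   nu p *: (- (cos phi *: alpha p) + sin phi *: beta p)).

Definition dom_Psi : set (R4 R * R4 R) :=
  [set p | TS3 p /\ 0 < p.1.1 < 1].

Definition Psi p : R3 R * R3 R := (p.1.1^-1 *: p.1.2, bpi p).

Definition HK s : R := 2^-1 * dot s.2 s.2 - gamma / enorm s.1.

Definition dom_Phi_c : set (R3 R * R3 R) :=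
  [set s | s.1 <> 0 /\ HK s < 0].

Definition nu_c s : R := gamma / Num.sqrt (- (2 * HK s)).

Definition alpha_c s : R4 R :=
  (1 / nu_c s * dot s.2 s.1,
   (enorm s.1)^-1 *: s.1 - (dot s.2 s.1 / gamma) *: s.2).

Definition beta_c s : R4 R :=
  (enorm s.1 / gamma * dot s.2 s.2 - 1,
   (enorm s.1 / nu_c s) *: s.2).

Definition Phi_c s : R4 R * R4 R :=
  let phi : R := (alpha_c s).1 in
  (sin phi *: alpha_c s + cos phi *: beta_c s,
   nu_c s *: (- (cos phi *: alpha_c s) + sin phi *: beta_c s)).

End Maps.

(* Main.v *)
Require Import Defs.
From mathcomp Require Import all_boot all_order all_algebra.
From mathcomp Require Import classical_sets reals trigo.

Import Order.TTheory GRing.Theory Num.Theory.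

Local Open Scope classical_set_scope.
Local Open Scope ring_scope.

(** The gnomonic map sends [q] to [Q = q / q_0] and keeps the momentum [pi].
    The potential on the sphere is a multiple of the cotangent [q_0 / |q|] of the
    polar angle, which equals [1 / |Q|] once [q_0 > 0]; so the two energies agree
    ([HK_Psi]), and hence so do the values of [nu].  Each component of [alpha] and [beta] depends on
    the base point only through [Q], since [q] occurs there in the combinations
    [q / q_0], [|q| / q_0] and [q / |q|]; so the pairs [alpha], [beta] of the two
    problems coincide, and both Ligon-Schaaf maps are the same expression in
    [alpha], [beta] and [nu].

    The positivity of [q_0] comes from the energy ([energy_lt0_pos]): the kinetic
    term is nonnegative, so a negative energy forces [q_0 / |q| > 0].  Then
    [|q| > 0] keeps [q_0] below 1 on the unit sphere ([TS3_lt1]). *)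

Lemma dotC (R : realType) (x y : 'rV[R]_3) : dot x y = dot y x.
Proof. by apply: eq_bigr => i _; rewrite mulrC. Qed.

Lemma dotZl (R : realType) (a : R) (x y : 'rV[R]_3) :
  dot (a *: x) y = a * dot x y.
Proof. by rewrite /dot mulr_sumr; apply: eq_bigr => i _; rewrite mxE mulrA. Qed.

Lemma dot_ge0 (R : realType) (x : 'rV[R]_3) : 0 <= dot x x.
Proof. by apply: sumr_ge0 => i _; rewrite -expr2 sqr_ge0. Qed.

Lemma enorm_sqr (R : realType) (x : 'rV[R]_3) : enorm x ^+ 2 = dot x x.
Proof. by rewrite sqr_sqrtr ?dot_ge0. Qed.

Lemma enorm0 (R : realType) : enorm (0 : 'rV[R]_3) = 0.
Proof. by rewrite /enorm -(scale0r 0) dotZl mul0r sqrtr0. Qed.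

Lemma enormZ (R : realType) (a : R) (x : 'rV[R]_3) :
  0 <= a -> enorm (a *: x) = a * enorm x.
Proof.
move=> a0; rewrite /enorm dotZl dotC dotZl mulrA -expr2.
by rewrite sqrtrM ?sqr_ge0 // sqrtr_sqr ger0_norm.
Qed.

(** The kinetic term is nonnegative, so the cotangent [q_0 / |q|] must be
    positive.  Both signs follow at once: the norm is nonnegative, and a zero
    norm would make the quotient zero because [0^-1 = 0]. *)
Lemma energy_lt0_pos (R : realType) (gamma : R) (p : R4 R * R4 R) :
  0 < gamma -> energy gamma p < 0 -> 0 < p.1.1 /\ 0 < enorm p.1.2.
Proof.
move=> g0; rewrite /energy subr_lt0 => Elt0.
have cot_gt0 : 0 < p.1.1 / enorm p.1.2.
  rewrite -(pmulr_rgt0 _ g0); apply: le_lt_trans Elt0.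
  by rewrite mulr_ge0 ?invr_ge0 ?ler0n ?sqr_ge0.
have r0 : 0 < enorm p.1.2.
  rewrite lt_def sqrtr_ge0 andbT; apply: contraTneq cot_gt0 => ->.
  by rewrite invr0 mulr0 ltxx.
by move: cot_gt0; rewrite pmulr_lgt0 ?invr_gt0.
Qed.

Lemma TS3_lt1 (R : realType) (p : R4 R * R4 R) :
  TS3 p -> 0 < enorm p.1.2 -> p.1.1 < 1.
Proof.
move=> [q1 _] r0; rewrite ltNge; apply/negP => q0_ge1.
have : 1 < dot4 p.1 p.1.
  rewrite /dot4 -enorm_sqr -[ltLHS]addr0 ler_ltD ?exprn_gt0 //.
  by rewrite -expr2 expr_ge1 ?(le_trans ler01).
by rewrite q1 ltxx.
Qed.

Section Gnomonic.
Variables (R : realType) (gamma : R) (p : R4 R * R4 R).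
Hypothesis q0_gt0 : 0 < p.1.1.

Lemma enorm_Psi : enorm (Psi p).1 = enorm p.1.2 / p.1.1.
Proof. by rewrite enormZ ?invr_ge0 1?ltW // mulrC. Qed.

Lemma dot_Psi : dot (Psi p).2 (Psi p).1 = dot p.1.2 (bpi p) / p.1.1.
Proof. by rewrite dotC dotZl mulrC. Qed.

Lemma HK_Psi : HK gamma (Psi p) = energy gamma p.
Proof. by rewrite /HK enorm_Psi invf_div /energy enorm_sqr. Qed.

Lemma nu_Psi : nu_c gamma (Psi p) = nu gamma p.
Proof. by rewrite /nu_c HK_Psi. Qed.

Lemma alpha_Psi : alpha_c gamma (Psi p) = alpha gamma p.
Proof.
rewrite /alpha_c nu_Psi dot_Psi enorm_Psi /alpha; congr (_, _ - _ *: _).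
- by rewrite !mul1r [(nu _ _ * _)^-1]invfM mulrA mulrAC.
- by rewrite {1}/Psi /= scalerA invf_div mulrAC divff ?gt_eqF // mul1r.
- by rewrite invfM mulrA mulrAC.
Qed.

Lemma beta_Psi : beta_c gamma (Psi p) = beta gamma p.
Proof.
rewrite /beta_c nu_Psi enorm_Psi /beta; congr (_ * _ - _, _ *: _).
- by rewrite invfM mulrA mulrAC.
- by rewrite [(nu _ _ * _)^-1]invfM mulrA mulrAC.
Qed.

Lemma Phi_c_Psi : Phi_c gamma (Psi p) = Phi gamma p.
Proof. by rewrite /Phi_c alpha_Psi beta_Psi nu_Psi. Qed.

End Gnomonic.

Theorem proposition6p5 (R : realType) (gamma : R) (hgamma : 0 < gamma)
    (p : (R^o * 'rV[R]_3) * (R^o * 'rV[R]_3)) (hp : P_minus gamma p) :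
  [/\ dom_Psi p,
      dom_Phi_c gamma (Psi p)
    & Phi_c gamma (Psi p) = Phi gamma p].
Proof.
case: hp => pTS [_ Elt0].
have [q0_gt0 r_gt0] := energy_lt0_pos _ _ _ hgamma Elt0.
split; last exact: Phi_c_Psi.
- by split=> //; rewrite q0_gt0 (TS3_lt1 _ _ pTS r_gt0).
- split; last by rewrite HK_Psi.
  move=> Q0; have : 0 < enorm (Psi p).1 by rewrite enorm_Psi // divr_gt0.
  by rewrite Q0 enorm0 ltxx.
Qed.
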